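(* Let $Y_t=A_{E_t}\in\mathcal{S}$, where $E_t$ is the inverse of a stable subordinator of index $\alpha$. Then for every $t,t_0>0$ the law of $Y_t^{t_0}=Y_{t+t_0}-Y_{t_0}$ approaches the law of $Y_t$ as $\alpha\to1$ (from below), in the sense of convergence in distribution: for every bounded continuous $f:\mathbb{R}\to\mathbb{R}$, $$\lim_{\alpha\uparrow 1}\Big(E\big[f(Y_t^{t_0})\big]-E\big[f(Y_t)\big]\Big)=0,$$ where for each $\alpha\in(0,1)$ both $Y_t^{t_0}$ and $Y_t$ are formed with the same index $\alpha$.
   Context: $\mathcal{S}$ is the class of processes $Y_t=A_{E_t}$, where $(A_t)_{t\ge0}$ is a real-valued Lévy process with $A_0=0$ and $E_t=\inf\{s:D_s>t\}$ is the inverse of a stable subordinator $(D_t)_{t\ge0}$ of index $0<\alpha<1$, with $D_0=0$ and $E(e^{-uD_t})=e^{-tcu^{\alpha}}$ for $u\ge0$, independent of $(A_t)$. In the limit $\alpha\to1$, the law of the Lévy process $A$ and the constant $c>0$ are held fixed, while $D$ (hence $E$ and $Y$) depends on $\alpha$. *)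

(* Defs.v *)
From HB Require Import structures.
From mathcomp Require Import all_boot all_order all_algebra.
From mathcomp Require Import all_classical all_reals all_analysis.

Set Implicit Arguments.
Unset Strict Implicit.
Unset Printing Implicit Defensive.

Import Order.TTheory GRing.Theory Num.Theory.
Import numFieldTopology.Exports numFieldNormedType.Exports.

Local Open Scope classical_set_scope.
Local Open Scope ring_scope.

(* A process with time set [0, +oo[ is a family X : R -> {RV P >-> R}; only the
   times t >= 0 are constrained, and the X t with t < 0 are irrelevant. *)

(* t^'+ and t^'- are filters of punctured one-sided neighbourhoods of t. *)
Definition cadlag (R : realType) (x : R -> R) : Prop :=
  (forall t, 0 <= t -> x s @[s --> t^'+] --> x t) /\
  (forall t, 0 < t -> cvg (x s @[s --> t^'-])).

(* The product rule for subfamilies is the case where some B i are setT. *)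
Definition mutually_independent (d : measure_display) (T : measurableType d)
    (R : realType) (P : probability T R) (n : nat) (X : 'I_n -> T -> R) : Prop :=
  forall B : 'I_n -> set R, (forall i, measurable (B i)) ->
    P (\bigcap_i (X i @^-1` B i)) = (\prod_(i < n) P (X i @^-1` B i))%E.

Definition process_sigma_algebra (d : measure_display) (T : measurableType d)
    (R : realType) (P : probability T R) (X : R -> {RV P >-> R}) : set (set T) :=
  <<s \bigcup_(s in [set s : R | 0 <= s])
        preimage_set_system setT (X s) measurable >>.

Definition independent_processes (d : measure_display) (T : measurableType d)
    (R : realType) (P : probability T R) (X Y : R -> {RV P >-> R}) : Prop :=
  forall U V, process_sigma_algebra X U -> process_sigma_algebra Y V ->
    P (U `&` V) = (P U * P V)%E.

(* The path properties hold almost surely, in the sense that they may fail only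
   inside a measurable null set. *)
Record levy_process (d : measure_display) (T : measurableType d)
    (R : realType) (P : probability T R) (X : R -> {RV P >-> R}) : Prop := {
  levy_start : {ae P, forall w, X 0 w = 0};
  levy_independent_increments : forall (n : nat) (t : nat -> R),
    0 <= t 0%N -> {homo t : i j / (i <= j)%N >-> i <= j} ->
    mutually_independent P (fun i : 'I_n => X (t i.+1) \- X (t i));
  levy_stationary_increments : forall (s h : R) (B : set R),
    0 <= s -> 0 <= h -> measurable B ->
    pushforward P (X (s + h) \- X s) B = pushforward P (X h \- X 0) B;
  levy_cadlag : {ae P, forall w, cadlag (fun t => X t w)} }.

Record stable_subordinator (d : measure_display) (T : measurableType d)
    (R : realType) (P : probability T R) (alpha c : R)
    (D : R -> {RV P >-> R}) : Prop := {
  subordinator_levy : levy_process D;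
  subordinator_nondecreasing :
    {ae P, forall w, forall s t : R, 0 <= s -> s <= t -> D s w <= D t w};
  subordinator_laplace : forall t u : R, 0 <= t -> 0 <= u ->
    ('E_P[fun w => expR (- (u * D t w))%R])%E = (expR (- (t * c * u `^ alpha)))%:E }.

(* inf is real-valued, and 0 on the paths for which the set below is empty;
   these form a null set when D is a stable subordinator. *)
Definition inverse_process (R : realType) (T : Type) (D : R -> T -> R) :
    R -> T -> R :=
  fun t w => inf [set s : R | 0 <= s /\ t < D s w].

(* The process A_{E_t}, where E is the inverse of D. *)
Definition time_changed (R : realType) (T : Type) (A D : R -> T -> R) :
    R -> T -> R :=
  fun t w => A (inverse_process D t w) w.

(* Under these conditions time_changed A D is a member of the class S of index
   alpha. *)
Record class_S_data (d : measure_display) (T : measurableType d)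
    (R : realType) (P : probability T R) (alpha c : R)
    (A D : R -> {RV P >-> R}) : Prop := {
  class_S_levy : levy_process A;
  class_S_subordinator : stable_subordinator alpha c D;
  class_S_independent : independent_processes A D }.

(* Equality of the laws of two processes, possibly defined on different
   probability spaces: all their finite-dimensional laws agree. *)
Definition same_law (d1 d2 : measure_display) (T1 : measurableType d1)
    (T2 : measurableType d2) (R : realType)
    (P1 : probability T1 R) (P2 : probability T2 R)
    (X1 : R -> {RV P1 >-> R}) (X2 : R -> {RV P2 >-> R}) : Prop :=
  forall (n : nat) (t : 'I_n -> R) (B : set (n.-tuple R)),
    (forall i, 0 <= t i) -> measurable B ->
    P1 [set w | B [tuple X1 (t i) w | i < n]] =
    P2 [set w | B [tuple X2 (t i) w | i < n]].

(* Main.v *)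
Require Import Defs.
From mathcomp Require Import all_boot all_order all_algebra.
From mathcomp Require Import all_classical all_reals all_analysis.
From mathcomp Require Import measurable_realfun.
From mathcomp Require Import ring lra.

Set Implicit Arguments.
Unset Strict Implicit.
Unset Printing Implicit Defensive.

Import Order.TTheory GRing.Theory Num.Theory.
Import numFieldTopology.Exports numFieldNormedType.Exports.

Local Open Scope classical_set_scope.
Local Open Scope ring_scope.

(** Because D has Laplace exponent c u^alpha, the variable exp (- D_s) has mean
    exp (- s c), whatever alpha is, and its variance
    exp (- s c 2^alpha) - exp (- 2 s c) tends to 0 as alpha tends to 1.  By
    Chebyshev's inequality D_s therefore converges in probability to c s, and
    since D is nondecreasing, E_t converges in probability to t / c
    (lemma inverse_stable_concentration): in the limit the random clock becomes
    deterministic.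

    Y_t = A_(E_t) is thus A read at a time close to t / c.  A Levy process has
    almost surely no jump at a given time (lemma levy_ae_continuous_at), so the
    oscillation of A near t / c is small with high probability; this is a
    statement about the law of A alone, which does not depend on alpha, hence
    the smallness is uniform in alpha.  To turn this into expectations without
    uniform continuity or tightness, the event considered is directly that
    f (A_s - k A_r) differs from f (A_a - k A_b) by more than e for some times
    s near a and r near b (definition oscillation).  By right continuity it is
    enough to let s and r range over countably many times, so this event is
    measurable and its probability is determined by the finite-dimensional
    laws of A; it decreases to a null event as the neighbourhoods shrink.

    With k = 1 this compares E [f (Y_(t + t0) - Y_t0)] with
    E [f (A_((t + t0) / c) - A_(t0 / c))], and with k = 0 it compares
    E [f (Y_t)] with E [f (A_(t / c))].  The two expectations that involve A
    only are equal because the increments of A are stationary.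

    The random variable Y_t need not be measurable, since the path properties
    hold only outside a null set.  Expectations of f (Y_t) are therefore
    compared with those of measurable variables by means of bounds that do not
    require measurability of one of the two sides (lemma
    expectation_perturbation). *)

(** * Null events, and expectations of nonmeasurable functions *)

Lemma measurable_normr_ge (d : measure_display) (T : measurableType d)
    (R : realType) (g : T -> R) (e : R) :
  measurable_fun setT g -> measurable [set w | e <= `|g w|].
Proof.
move=> mg; have mng : measurable_fun setT (fun w => `|g w|).
  exact: measurableT_comp (@normr_measurable R setT) mg.
rewrite (_ : [set w | _] = (fun w => `|g w|) @^-1` `[e, +oo[%classic).
  by rewrite -[X in measurable X]setTI; exact: mng.
by apply/seteqP; split => w /=; rewrite in_itv/= andbT.
Qed.

Lemma measurable_normr_gt (d : measure_display) (T : measurableType d)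
    (R : realType) (g : T -> R) (e : R) :
  measurable_fun setT g -> measurable [set w | e < `|g w|].
Proof.
move=> mg; have mng : measurable_fun setT (fun w => `|g w|).
  exact: measurableT_comp (@normr_measurable R setT) mg.
rewrite (_ : [set w | _] = (fun w => `|g w|) @^-1` `]e, +oo[%classic).
  by rewrite -[X in measurable X]setTI; exact: mng.
by apply/seteqP; split => w /=; rewrite in_itv/= andbT.
Qed.

Lemma probability_cvg0 (d : measure_display) (T : measurableType d)
    (R : realType) (P : probability T R) (F : (set T)^nat) :
  (forall n, measurable (F n)) -> nonincreasing_seq F ->
  P.-negligible (\bigcap_n F n) -> P (F n) @[n --> \oo] --> 0%E.
Proof.
move=> mF Fdec F0.
have mI : measurable (\bigcap_n F n) by exact: bigcapT_measurable.
rewrite -((negligibleP P mI).1 F0).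
apply: nonincreasing_cvg_mu => //.
exact: le_lt_trans (probability_le1 _ _) (ltry _).
Qed.

(** The integral of a nonnegative function is a supremum over the simple
    functions below it, which is monotone even for functions that are not
    measurable. *)
Lemma le_integral_nonmeasurable (d : measure_display) (T : measurableType d)
    (R : realType) (mu : {measure set T -> \bar R}) (f g : T -> \bar R) :
  (forall x, 0 <= f x)%E -> (forall x, f x <= g x)%E ->
  (\int[mu]_x f x <= \int[mu]_x g x)%E.
Proof.
move=> f0 fg.
rewrite !ge0_integralTE//; last by move=> x; exact: le_trans (f0 x) (fg x).
apply: le_ereal_sup => _ [h hf <-]; exists h => // x.
exact: le_trans (hf x) (fg x).
Qed.

(** Additivity of the integral fails for the nonmeasurable h, so it is only
    used for two sums of measurable functions: g + W, which lies above h, and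
    p + W, where p = max (g - W) 0 lies below h. *)
Lemma integral_perturbation (d : measure_display) (T : measurableType d)
    (R : realType) (P : probability T R) (h g W : T -> R) :
  measurable_fun setT g -> measurable_fun setT W ->
  (forall x, 0 <= h x) -> (forall x, 0 <= g x) ->
  (forall x, `|h x - g x| <= W x) ->
  (\int[P]_x (h x)%:E <= \int[P]_x (g x)%:E + \int[P]_x (W x)%:E)%E /\
  (\int[P]_x (g x)%:E <= \int[P]_x (h x)%:E + \int[P]_x (W x)%:E)%E.
Proof.
move=> mg mW h0 g0 hgW.
have W0 x : 0 <= W x by exact: le_trans (hgW x).
split.
  rewrite -ge0_integralD//=; first last.
  - exact/measurable_EFinP.
  - by move=> x _; rewrite lee_fin.
  - exact/measurable_EFinP.
  - by move=> x _; rewrite lee_fin.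
  apply: le_integral_nonmeasurable => x; first by rewrite lee_fin.
  rewrite -[leRHS]/((g x + W x)%:E) lee_fin.
  by move: (hgW x); rewrite ler_norml => /andP[]; lra.
pose p x := Num.max (g x - W x) 0.
have mp : measurable_fun setT p.
  by apply: measurable_maxr => //; exact: measurable_funB.
have p0 x : 0 <= p x by rewrite le_max lexx orbT.
apply: (@le_trans _ _ (\int[P]_x (p x)%:E + \int[P]_x (W x)%:E)%E); last first.
  rewrite leeD2r//; apply: le_integral_nonmeasurable => x; rewrite lee_fin//.
  rewrite ge_max h0 andbT.
  by move: (hgW x); rewrite ler_norml => /andP[]; lra.
rewrite -ge0_integralD//=; first last.
- exact/measurable_EFinP.
- by move=> x _; rewrite lee_fin.
- exact/measurable_EFinP.
- by move=> x _; rewrite lee_fin.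
apply: le_integral_nonmeasurable => x; rewrite ?lee_fin//.
by rewrite /p -lerBlDr le_max lexx.
Qed.

Lemma maxr0_lipschitz (R : realDomainType) (x y : R) :
  `|Num.max x 0 - Num.max y 0| <= `|x - y|.
Proof.
have := ler_norm (x - y); have := ler_norm (y - x); rewrite (distrC y x).
rewrite ler_norml /Num.max; case: ifPn; case: ifPn; rewrite -?leNgt;
  by move=> *; apply/andP; split; have := normr_ge0 (x - y); lra.
Qed.

(** This is the tool by which f (Y_t), whose measurability is not known, is
    replaced by a function of A at a deterministic time. The positive and
    negative parts are treated separately, each costing the integral of the
    error bound W; hence the factor 2. *)
Lemma expectation_perturbation (d : measure_display) (T : measurableType d)
    (R : realType) (P : probability T R) (h g : T -> R) (M e : R) (B : set T) :
  measurable_fun setT g -> measurable B -> 0 <= M -> 0 <= e ->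
  (forall w, `|h w| <= M) -> (forall w, `|g w| <= M) ->
  (forall w, ~ B w -> `|h w - g w| <= e) ->
  [/\ 'E_P[h]%E \is a fin_num, 'E_P[g]%E \is a fin_num &
    `|fine 'E_P[h]%E - fine 'E_P[g]%E| <= 2 * (e + 2 * M * fine (P B))].
Proof.
move=> mg mB M0 e0 hM gM hg.
pose W w := e + 2 * M * \1_B w.
have mW : measurable_fun setT W.
  by apply: measurable_funD => //; apply: measurable_funM.
have hgW w : `|h w - g w| <= W w.
  rewrite /W indicE; have [|/negP nB] := boolP (w \in B); last first.
    by rewrite mulr0 addr0 hg// => /mem_set.
  rewrite mulr1 => _; apply: (le_trans (ler_normB _ _)).
  by have := hM w; have := gM w; lra.
have W0 w : 0 <= W w by exact: le_trans (hgW w).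
have iW : (\int[P]_w (W w)%:E = (e + 2 * M * fine (P B))%:E)%E.
  under eq_integral do rewrite /W EFinD EFinM.
  rewrite ge0_integralD//=; first last.
  - by apply/measurable_EFinP; apply: measurable_funM.
  - by move=> x _; rewrite lee_fin !mulr_ge0.
  rewrite ge0_integralZl//=; first last.
  - by rewrite lee_fin mulr_ge0.
  - by apply/measurable_EFinP.
  rewrite integral_indic// setIT integral_cst//= probability_setT mule1.
  by rewrite [in RHS]EFinD [in RHS]EFinM fineK// fin_num_measure.
have bound (k : T -> R) : (forall w, 0 <= k w <= M) ->
    (\int[P]_w (k w)%:E)%E \is a fin_num.
  move=> kM; rewrite ge0_fin_numE; last first.
    by apply: integral_ge0 => w _; rewrite lee_fin; case/andP: (kM w).
  apply: (@le_lt_trans _ _ (\int[P]_w M%:E)%E).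
    apply: le_integral_nonmeasurable => w; rewrite lee_fin;
      by case/andP: (kM w).
  by rewrite integral_cst//= probability_setT mule1 ltry.
have decomp (k : T -> R) : (forall w, `|k w| <= M) ->
    [/\ (\int[P]_w (Num.max (k w) 0)%:E)%E \is a fin_num,
        (\int[P]_w (Num.max (- k w) 0)%:E)%E \is a fin_num &
        'E_P[k]%E = (\int[P]_w (Num.max (k w) 0)%:E -
          \int[P]_w (Num.max (- k w) 0)%:E)%E].
  move=> kM; split.
  - apply: bound => w; rewrite le_max lexx orbT/= ge_max M0 andbT.
    exact: le_trans (ler_norm _) (kM w).
  - apply: bound => w; rewrite le_max lexx orbT/= ge_max M0 andbT.
    by rewrite (le_trans (ler_norm _))// normrN.
  - rewrite unlock integralE; congr (_ - _)%E.
    + by apply: eq_integral => w _; rewrite EFin_max funeposE.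
    + by apply: eq_integral => w _; rewrite EFin_max funenegE EFinN.
have [hp hn ->] := decomp h hM; have [gp gn ->] := decomp g gM.
have [] := @integral_perturbation _ _ _ P (fun w => Num.max (h w) 0)
    (fun w => Num.max (g w) 0) W.
- exact: measurable_maxr.
- by [].
- by move=> w; rewrite le_max lexx orbT.
- by move=> w; rewrite le_max lexx orbT.
- by move=> w; apply: le_trans (hgW w); exact: maxr0_lipschitz.
have [] := @integral_perturbation _ _ _ P (fun w => Num.max (- h w) 0)
    (fun w => Num.max (- g w) 0) W.
- by apply: measurable_maxr => //; exact: measurableT_comp.
- by [].
- by move=> w; rewrite le_max lexx orbT.
- by move=> w; rewrite le_max lexx orbT.
- move=> w; apply: le_trans (hgW w).
  by rewrite -(normrN (h w - g w)) opprD; exact: maxr0_lipschitz.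
rewrite iW.
move: hp hn gp gn => /fineK <- /fineK <- /fineK <- /fineK <-.
rewrite -!EFinD !lee_fin /= => i1 i2 i3 i4; split => //.
by rewrite ler_norml; apply/andP; split; lra.
Qed.

(** * Absence of fixed jumps *)

(** A jump at time a would be the limit of the increments over [a - h, a],
    which by stationarity have the law of X_h - X_0; the latter tends to 0 in
    probability by right continuity at 0. *)
Lemma levy_ae_continuous_at (d : measure_display) (T : measurableType d)
    (R : realType) (P : probability T R) (X : R -> {RV P >-> R}) (a : R) :
  levy_process X -> 0 < a ->
  {ae P, forall w, X s w @[s --> a] --> X a w}.
Proof.
move=> LX a0.
pose h (n : nat) : R := a / n.+1%:R.
have h0 n : 0 < h n by rewrite divr_gt0.
have ha n : h n <= a by rewrite ler_pdivrMr// ler_peMr ?ler1n//; exact: ltW.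
have hcvg : h n @[n --> \oo] --> 0.
  by rewrite -(mulr0 a); apply: cvgMl_tmp; exact: cvg_harmonic.
pose big (m : nat) : set R := [set x | m.+1%:R^-1 < `|x|].
have mbig m : measurable (big m) by exact: measurable_normr_gt.
pose S m n : set T := (X a \- X (a - h n)) @^-1` big m.
pose S' m n : set T := (X (h n) \- X 0) @^-1` big m.
have mS m n : measurable (S m n).
  by rewrite -[X in measurable X]setTI; apply: measurable_funB.
have mS' m n : measurable (S' m n).
  by rewrite -[X in measurable X]setTI; apply: measurable_funB.
(* Stationarity moves increments that end at a to increments that start at 0. *)
have SS' m n : P (S m n) = P (S' m n).
  have := levy_stationary_increments LX (s := a - h n) (h := h n) (B := big m).
  by rewrite /pushforward subrK; apply => //; rewrite ?subr_ge0// ltW.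
have [/= N [mN PN subN]] := levy_cadlag LX.
(* The tail unions U m n decrease to a null event, by right continuity at 0. *)
pose U m n := \bigcup_(j in [set j | (n <= j)%N]) S' m j.
have mU m n : measurable (U m n) by apply: bigcup_measurable.
have U0 m : P (U m n) @[n --> \oo] --> 0%E.
  apply: probability_cvg0 => //.
    move=> i j ij; apply/subsetPset => w [k /= jk Sk].
    by exists k => //=; exact: leq_trans ij jk.
  exists N; split => // w Uw; apply: subN => /= -[rc _].
  have {}rc : X (h n) w @[n --> \oo] --> X 0 w.
    have := rc 0 (lexx _).
    move/cvg_at_rightP; apply; split => //.
  move/cvgrPdist_lt : rc => /(_ m.+1%:R^-1); rewrite invr_gt0 ltr0n => /(_ isT).
  case=> n _ /= Hn; have [k /= nk] := Uw n I.
  by rewrite /S'/big/= ltNge distrC ltW// Hn.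
(* A jump at a larger than 1 / m.+1 puts the path in Z m n for large n. *)
pose Z m n := \bigcap_(j in [set j | (n <= j)%N]) S m j.
have mZ m n : measurable (Z m n).
  by apply: bigcap_measurable => //; exists n => /=.
have Z0 m n : P.-negligible (Z m n).
  apply/negligibleP => //; apply/eqP; rewrite eq_le measure_ge0 andbT.
  apply: (cvge_ge _ (U0 m)).
  near=> j; apply: (@le_trans _ _ (P (S m j))).
    apply: le_measure; rewrite ?inE//; apply: bigcap_inf => /=.
    by near: j; exact: nbhs_infty_ge.
  rewrite SS'; apply: le_measure; rewrite ?inE// => w Sw.
  by exists j => /=.
have : P.-negligible (N `|` \bigcup_m \bigcup_n Z m n).
  apply: negligibleU; first exact/negligibleP.
  by do 2 apply: negligible_bigcup => ?.
apply: negligibleS => w /= nc; apply: contrapT => /not_orP[Nw Zw]; apply: nc.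
have [rc lc] : cadlag (X ^~ w) by apply: contrapT => /subN.
apply/left_right_continuousP; split; last exact: rc (ltW a0).
have /cvg_ex[/= L XL] := lc _ a0.
suff -> : X a w = L by [].
apply/eqP; rewrite -subr_eq0 -normr_eq0; apply/eqP.
apply: contrapT => /eqP; rewrite normr_eq0 -normr_gt0 => Lgt0.
have [m mL] : exists m : nat, m.+1%:R^-1 < `|X a w - L|.
  have [k _ Hk] := near_infty_natSinv_lt (PosNum Lgt0).
  by exists k; exact: (Hk k (leqnn k)).
apply: Zw; exists m => //.
have {}XL : X (a - h n) w @[n --> \oo] --> L.
  move/cvg_at_leftP : XL; apply; split.
    by move=> n; rewrite ltrBlDr ltrDl.
  by rewrite -[X in _ --> X]subr0; apply: cvgB => //; exact: cvg_cst.
have : `|X a w - X (a - h n) w| @[n --> \oo] --> `|X a w - L|.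
  by apply: cvg_norm; apply: cvgB => //; exact: cvg_cst.
move/cvgr_gt => /(_ _ mL) [n _ Hn]; exists n.
Unshelve. all: by end_near. Qed.

(** * Oscillation of a process at two times *)

(** The reference times a and b are put first so that every finite segment of
    the enumeration contains them; the absolute value keeps all times
    nonnegative, where the finite-dimensional laws are prescribed. *)
Definition sample_times (R : realType) (a b : R) (n : nat) : R :=
  match n with
  | 0 => a
  | 1 => b
  | m.+2 => `|ratr (odflt 0 (unpickle m : option rat))|
  end.

Lemma sample_times_ge0 (R : realType) (a b : R) (n : nat) :
  0 < a -> 0 < b -> 0 <= sample_times a b n.
Proof. by case: n => [|[|n]] /= /ltW + /ltW. Qed.

Lemma sample_times_dense (R : realType) (a b x y : R) :
  0 <= x -> x < y -> exists n, x < sample_times a b n < y.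
Proof.
move=> x0 xy; have [r] := rat_in_itvoo xy; rewrite in_itv/= => /andP[xr ry].
exists (pickle r).+2; rewrite /= pickleK/= ger0_norm ?xr//.
exact: le_trans x0 (ltW xr).
Qed.

Lemma right_limit_le_samples (R : realType) (a b s e m : R) (g : R -> R) :
  0 <= s -> s < m -> g u @[u --> s^'+] --> g s ->
  (forall n, s < sample_times a b n < m -> g (sample_times a b n) <= e) ->
  g s <= e.
Proof.
move=> s0 sm gs gq; rewrite leNgt; apply/negP => egs.
have : \forall u \near s^'+, e < g u by move/cvgr_gt : gs; apply.
move=> [r /= r0 Hr].
have [n /andP[sn]] := @sample_times_dense R a b s (Num.min m (s + r)) s0
  ltac:(by rewrite lt_min sm ltrDl).
rewrite lt_min => /andP[nm nr].
have := gq n; rewrite sn nm => /(_ isT); rewrite leNgt => /negP; apply.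
apply: Hr => //=; rewrite distrC gtr0_norm ?subr_gt0//.
by rewrite ltrBlDl.
Qed.

(** Written as a set of tuples, so that the event below is a union of events
    that are determined by the finite-dimensional laws. The entries 0 and 1 of
    the tuple are the values at the reference times q 0 and q 1. *)
Definition oscillation_set (R : realType) (f : R -> R) (k e delta : R)
    (q : nat -> R) (n : nat) : set (n.+2.-tuple R) :=
  [set x | exists ij : 'I_n.+2 * 'I_n.+2,
    [/\ `|q ij.1 - q 0%N| < delta, `|q ij.2 - q 1%N| < delta &
        e < `|f (tnth x ij.1 - k * tnth x ij.2) -
              f (tnth x 0 - k * tnth x 1)| ] ].

Definition oscillation (R : realType) (T : Type) (X : R -> T -> R)
    (f : R -> R) (k a b e delta : R) : set T :=
  \bigcup_n [set w | oscillation_set f k e delta (sample_times a b)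
                       [tuple X (sample_times a b i) w | i < n.+2]].

Lemma oscillationP (R : realType) (T : Type) (X : R -> T -> R)
    (f : R -> R) (k a b e delta : R) (w : T) :
  oscillation X f k a b e delta w <->
  exists i j : nat, let q := sample_times a b in
    [/\ `|q i - a| < delta, `|q j - b| < delta &
        e < `|f (X (q i) w - k * X (q j) w) - f (X a w - k * X b w)| ].
Proof.
split=> [[n _ [[i j] /= []]]|[i [j /= [ia jb eX]]]].
  by rewrite !tnth_mktuple => ia jb eX; exists i, j.
have im : (i < (maxn i j).+2)%N by rewrite ltnS leqW// leq_maxl.
have jm : (j < (maxn i j).+2)%N by rewrite ltnS leqW// leq_maxr.
exists (maxn i j) => //; exists (Ordinal im, Ordinal jm).
by rewrite !tnth_mktuple.
Qed.

Lemma measurable_oscillation_set (R : realType) (f : R -> R) (k e delta : R)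
    (q : nat -> R) (n : nat) :
  continuous f -> measurable (@oscillation_set R f k e delta q n).
Proof.
move=> fc; have mf := continuous_measurable_fun fc.
pose V (ij : 'I_n.+2 * 'I_n.+2) : set (n.+2.-tuple R) := 
  [set x | e < `|f (tnth x ij.1 - k * tnth x ij.2) -
              f (tnth x 0 - k * tnth x 1)| ].
rewrite (_ : @oscillation_set R f k e delta q n = \bigcup_(ij in
  [set ij : 'I_n.+2 * 'I_n.+2 |
    `|q ij.1 - q 0%N| < delta /\ `|q ij.2 - q 1%N| < delta]) V ij).
  apply: fin_bigcup_measurable; first exact: finite_finset.
  move=> [i j] _; apply: measurable_normr_gt.
  have mh (i' j' : 'I_n.+2) : measurable_fun [set: n.+2.-tuple R]
      (fun x => f (tnth x i' - k * tnth x j')).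
    apply: measurableT_comp => //; apply: measurable_funB.
      exact: measurable_tnth.
    by apply: measurable_funM => //; exact: measurable_tnth.
  exact: measurable_funB.
apply/seteqP; split => x /=; first by case=> ij [h1 h2 h3]; exists ij.
by case=> ij [h1 h2] h3; exists ij.
Qed.

Lemma measurable_sampled_set (d : measure_display) (T : measurableType d)
    (R : realType) (P : probability T R) (X : R -> {RV P >-> R}) (n : nat)
    (t : 'I_n -> R) (B : set (n.-tuple R)) :
  measurable B -> measurable [set w | B [tuple X (t i) w | i < n]].
Proof.
move=> mB; have : measurable_fun setT (fun w => [tuple X (t i) w | i < n]).
  apply/measurable_fun_tnthP => i.
  rewrite (_ : _ \o _ = X (t i)); first exact: measurable_funPT.
  by apply/funext => w /=; rewrite tnth_mktuple.
by move=> /(_ measurableT _ mB); rewrite setTI.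
Qed.

Lemma measurable_oscillation (d : measure_display) (T : measurableType d)
    (R : realType) (P : probability T R) (X : R -> {RV P >-> R})
    (f : R -> R) (k a b e delta : R) :
  continuous f -> measurable (oscillation (X : R -> T -> R) f k a b e delta).
Proof.
move=> fc; apply: bigcupT_measurable => n; apply: measurable_sampled_set.
exact: measurable_oscillation_set.
Qed.

(** The oscillation event is an increasing union of events that depend on
    finitely many times. *)
Lemma same_law_oscillation (d1 d2 : measure_display) (T1 : measurableType d1)
    (T2 : measurableType d2) (R : realType)
    (P1 : probability T1 R) (P2 : probability T2 R)
    (X1 : R -> {RV P1 >-> R}) (X2 : R -> {RV P2 >-> R})
    (f : R -> R) (k a b e delta : R) :
  continuous f -> 0 < a -> 0 < b -> same_law X1 X2 ->
  P1 (oscillation (X1 : R -> T1 -> R) f k a b e delta) =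
  P2 (oscillation (X2 : R -> T2 -> R) f k a b e delta).
Proof.
move=> fc a0 b0 X12.
have lim (d : measure_display) (T : measurableType d) (P : probability T R)
    (X : R -> {RV P >-> R}) :
    P [set w | oscillation_set f k e delta (sample_times a b)
                 [tuple X (sample_times a b i) w | i < n.+2]] @[n --> \oo] -->
    P (oscillation (X : R -> T -> R) f k a b e delta).
  apply: nondecreasing_cvg_mu.
  - move=> n; apply: measurable_sampled_set.
    exact: measurable_oscillation_set.
  - exact: measurable_oscillation.
  - move=> n m nm; apply/subsetPset => w [[i j] /= []].
    rewrite !tnth_mktuple => ia jb eX.
    have nm2 : (n.+2 <= m.+2)%N by [].
    exists (widen_ord nm2 i, widen_ord nm2 j) => /=.
    by rewrite !tnth_mktuple.
apply: (cvg_unique _ (lim _ _ _ X1)) => //.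
rewrite (_ : (fun n => P1 _) = (fun n => P2 
   [set w | oscillation_set f k e delta (sample_times a b)
                 [tuple X2 (sample_times a b i) w | i < n.+2]])).
  exact: lim.
apply/funext => n.
apply: (X12 _ (fun i : 'I_n.+2 => sample_times a b i)) => [i|].
  exact: sample_times_ge0.
exact: measurable_oscillation_set.
Qed.

(** Although the event only tests countably many times, its complement bounds
    the oscillation at all times: every time is a limit from the right of
    sampled times, and the paths are right continuous. The two times are moved
    one after the other. *)
Lemma oscillation_bound (R : realType) (T : Type) (X : R -> T -> R)
    (f : R -> R) (k a b e delta s r : R) (w : T) :
  continuous f -> cadlag (X ^~ w) -> ~ oscillation X f k a b e delta w ->
  0 <= s -> 0 <= r -> `|s - a| < delta -> `|r - b| < delta ->
  `|f (X s w - k * X r w) - f (X a w - k * X b w)| <= e.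
Proof.
move=> fc [Xr _] nosc s0 r0 sa rb.
pose q := sample_times a b.
have norm_near c u v :
    `|u - c| < delta -> u < v < c + delta -> `|v - c| < delta.
  rewrite !ltr_norml => /andP[u1 u2] /andP[v1 v2]; apply/andP; split; lra.
have lt_end c u : `|u - c| < delta -> u < c + delta.
  by rewrite ltr_norml => /andP[u1 u2]; lra.
have base i j : `|q i - a| < delta -> `|q j - b| < delta ->
   `|f (X (q i) w - k * X (q j) w) - f (X a w - k * X b w)| <= e.
  move=> ia jb; rewrite leNgt; apply/negP => eX; apply: nosc.
  by apply/oscillationP; exists i, j.
have half j : `|q j - b| < delta ->
   `|f (X s w - k * X (q j) w) - f (X a w - k * X b w)| <= e.
  move=> jb.
  apply: (@right_limit_le_samples R a b s e (a + delta)
    (fun u => `|f (X u w - k * X (q j) w) - f (X a w - k * X b w)|)) => //.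
  - exact: lt_end.
  - apply: cvg_norm; apply: cvgB; last exact: cvg_cst.
    apply: continuous_cvg; first exact: fc.
    by apply: cvgB; [exact: Xr|exact: cvg_cst].
  - by move=> n sn; apply: base => //; exact: norm_near sa sn.
apply: (@right_limit_le_samples R a b r e (b + delta)
  (fun u => `|f (X s w - k * X u w) - f (X a w - k * X b w)|)) => //.
- exact: lt_end.
- apply: cvg_norm; apply: cvgB; last exact: cvg_cst.
  apply: continuous_cvg; first exact: fc.
  apply: cvgB; first exact: cvg_cst.
  by apply: cvgMl_tmp; exact: Xr.
- by move=> n rn; apply: half; exact: norm_near rb rn.
Qed.

(** The paths are almost surely continuous at a and at b, hence so is f (X_s -
    k X_r) at (a, b). *)
Lemma oscillation_cvg0 (d : measure_display) (T : measurableType d)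
    (R : realType) (P : probability T R) (X : R -> {RV P >-> R})
    (f : R -> R) (k a b e : R) :
  levy_process X -> continuous f -> 0 < a -> 0 < b -> 0 < e ->
  P (oscillation (X : R -> T -> R) f k a b e n.+1%:R^-1) @[n --> \oo] --> 0%E.
Proof.
move=> LX fc a0 b0 e0; apply: probability_cvg0.
- by move=> n; exact: measurable_oscillation.
- move=> n m nm; apply/subsetPset => w /oscillationP[i [j [ia jb eX]]].
  have mn : m.+1%:R^-1 <= n.+1%:R^-1 :> R.
    by rewrite lef_pV2 ?posrE ?ltr0n// ler_nat ltnS.
  apply/oscillationP; exists i, j; split => //; exact: lt_le_trans mn.
have := levy_ae_continuous_at LX a0; have := levy_ae_continuous_at LX b0.
move=> negb nega; apply: negligibleS (negligibleU nega negb) => w osc.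
apply: contrapT => /not_orP[/= /contrapT Xa /contrapT Xb].
have : f (X u.1 w - k * X u.2 w) @[u --> (a, b)] --> f (X a w - k * X b w).
  apply: continuous_cvg; first exact: fc.
  apply: cvgB.
    by apply: (@cvg_comp _ _ _ fst (fun u => X u w) _ (nbhs a)) => //;
    exact: cvg_fst.
  apply: cvgMl_tmp.
  by apply: (@cvg_comp _ _ _ snd (fun u => X u w) _ (nbhs b)) => //;
    exact: cvg_snd.
move/cvgrPdist_le => /(_ _ e0) /nbhs_ballP[r /= r0 Hr].
have [n _ Hn] := near_infty_natSinv_lt (PosNum r0).
have /oscillationP[i [j [ia jb]]] := osc n I.
rewrite ltNge => /negP; apply; rewrite distrC.
apply: (Hr (sample_times a b i, sample_times a b j)); split => /=.
  rewrite /ball /= distrC; apply: lt_trans ia _; exact: (Hn n (leqnn n)).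
rewrite /ball /= distrC; apply: lt_trans jb _; exact: (Hn n (leqnn n)).
Qed.

(** * Concentration of the inverse subordinator *)

(** The Laplace transform at u = 1 and u = 2 gives the first two moments of
    exp (- D_s). The detour through exp (- D_s) is needed because D_s itself
    has infinite mean for s > 0. *)
Lemma subordinator_chebyshev (d : measure_display) (T : measurableType d)
    (R : realType) (P : probability T R) (alpha c : R) (D : R -> {RV P >-> R})
    (s eta : R) :
  stable_subordinator alpha c D -> 0 <= s -> 0 < eta ->
  (P [set w | (eta <= `|expR (- D s w) - expR (- (s * c))|)%R ] <=
    (eta ^- 2 * (expR (- (s * c * 2 `^ alpha)) - expR (- (2 * (s * c)))))%:E)%E.
Proof.
move=> SD s0 eta0.
pose m := expR (- (s * c)).
have m_sqr : m ^+ 2 = expR (- (2 * (s * c))).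
  by rewrite /m expr2 -expRD; congr expR; lra.
pose X w := expR (- D s w).
have mX : measurable_fun setT X.
  apply: measurableT_comp; first exact: measurable_expR.
  exact: measurableT_comp.
have E1 : (\int[P]_w (X w)%:E = m%:E)%E.
  have := subordinator_laplace SD s0 ler01; rewrite powR1 mulr1 unlock => <-.
  by apply: eq_integral => w _; rewrite mul1r.
have E2 : (\int[P]_w (X w ^+ 2)%:E = (expR (- (s * c * 2 `^ alpha)))%:E)%E.
  have := subordinator_laplace SD s0 (ler0n R 2); rewrite unlock => <-.
  by apply: eq_integral => w _; rewrite /X expr2 -expRD; congr (expR _)%:E; lra.
have mV : measurable_fun setT (fun w => (X w - m) ^+ 2).
  by apply: measurable_funX; exact: measurable_funB.
(* The square is expanded in the form V + 2 m E[X] = E[X^2] + m^2, in which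
   every term is nonnegative. *)
have V : (\int[P]_w ((X w - m) ^+ 2)%:E =
    (expR (- (s * c * 2 `^ alpha)) - expR (- (2 * (s * c))))%:E)%E.
  have : (\int[P]_w ((X w - m) ^+ 2)%:E + (2 * m)%:E * m%:E =
      (expR (- (s * c * 2 `^ alpha)))%:E + (m ^+ 2)%:E)%E.
    rewrite -{1}E1 -ge0_integralZl//=; first last.
    - by rewrite lee_fin mulr_ge0// expR_ge0.
    - by move=> w _; rewrite lee_fin expR_ge0.
    - exact/measurable_EFinP.
    rewrite -ge0_integralD//=; first last.
    - by apply/measurable_EFinP; exact: measurable_funM.
    - by move=> w _; rewrite lee_fin !mulr_ge0// expR_ge0.
    - exact/measurable_EFinP.
    - by move=> w _; rewrite lee_fin sqr_ge0.
    rewrite -E2 -[(m ^+ 2)%:E]mule1 -(@probability_setT _ _ _ P).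
    rewrite -integral_cst// -ge0_integralD//=; first last.
    - by move=> w _; rewrite lee_fin sqr_ge0.
    - by apply/measurable_EFinP; exact: measurable_funX.
    - by move=> w _; rewrite lee_fin sqr_ge0.
    apply: eq_integral => w _; rewrite -EFinM -!EFinD; congr _%:E.
    by rewrite sqrrB -mulr_natl; lra.
  rewrite -EFinM -EFinD -m_sqr => /eqP.
  rewrite eq_sym -sube_eq//; last first.
    by rewrite fin_num_adde_defl.
  by rewrite -EFinB => /eqP <-; congr _%:E; lra.
have mS : measurable [set w | eta <= `|X w - m| ].
  by apply: measurable_normr_ge; exact: measurable_funB.
have eta2 : 0 < eta ^+ 2 by rewrite exprn_gt0.
rewrite EFinM -V -lee_pdivrMl ?invr_gt0// invrK.
rewrite -[X in P X]setIT -integral_indic// -ge0_integralZl//=; first last.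
- by rewrite lee_fin ltW.
- by apply/measurable_EFinP.
apply: le_integral_nonmeasurable => w; rewrite -EFinM lee_fin.
  by rewrite mulr_ge0// ltW.
rewrite indicE; have [|_] := boolP (w \in _); last by rewrite mulr0 sqr_ge0.
by rewrite inE/= mulr1 -(real_normK (num_real (X w - m))) ler_sqr ?nnegrE// ltW.
Qed.

Lemma left_cvg1_stable_variance (R : realType) (x : R) :
  expR (- (x * 2 `^ alpha)) - expR (- (2 * x)) @[alpha --> (1 : R)^'-] --> 0.
Proof.
have -> : (0 : R) = expR (- (x * 2 `^ 1)) - expR (- (2 * x)).
  by rewrite powRr1// (mulrC x) subrr.
apply: (@cvg_at_left_filter R R (fun alpha => expR (- (x * 2 `^ alpha)) - _)).
apply: cvgB; last exact: cvg_cst.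
apply: continuous_cvg; first exact: continuous_expR.
apply: cvgN; apply: cvgMl_tmp.
rewrite /powR (gt_eqF (ltr0n R 2)).
apply: continuous_cvg; first exact: continuous_expR.
by apply: cvgMr_tmp; exact: cvg_id.
Qed.

(** Since D is nondecreasing, D (a - delta) <= t excludes all times before a -
    delta from the set whose infimum is taken, and t < D (a + delta) puts a +
    delta in it. *)
Lemma inverse_process_near (R : realType) (T : Type) (D : R -> T -> R)
    (a delta t : R) (w : T) :
  (forall s r : R, 0 <= s -> s <= r -> D s w <= D r w) ->
  0 < delta -> delta <= a -> D (a - delta) w <= t -> t < D (a + delta) w ->
  `|inverse_process D t w - a| <= delta.
Proof.
move=> Dnd delta0 da Dt tD.
set E := [set s : R | 0 <= s /\ t < D s w].
have Ea : E (a + delta) by split => //; rewrite addr_ge0//; lra.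
have lbE : lbound E (a - delta).
  move=> s [s0 ts]; rewrite leNgt; apply/negP => sa.
  have : D s w <= D (a - delta) w by apply: Dnd => //; exact: ltW.
  by move=> H; have := lt_le_trans ts (le_trans H Dt); rewrite ltxx.
have h1 : inf E <= a + delta by apply: ge_inf => //; exists (a - delta).
have h2 : a - delta <= inf E by apply: lb_le_inf => //; exists (a + delta).
by rewrite /inverse_process -/E ler_norml; apply/andP; split; lra.
Qed.

Lemma inverse_process_ge0 (R : realType) (T : Type) (D : R -> T -> R)
    (t : R) (w : T) : 0 <= inverse_process D t w.
Proof.
rewrite /inverse_process; set E := [set s : R | _].
have [->|/set0P E0] := eqVneq E set0; first by rewrite inf0.
by apply: lb_le_inf => // s [].
Qed.

(** The inverse of D at t is within h of a = t / c as soon as D (a - h) <= t <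
    D (a + h), and D (a - h), D (a + h) are close to t - c h and t + c h with
    high probability. *)
Lemma inverse_stable_concentration (R : realType) (c : R)
    (d : R -> measure_display) (T : forall alpha : R, measurableType (d alpha))
    (P : forall alpha : R, probability (T alpha) R)
    (D : forall alpha : R, R -> {RV (P alpha) >-> R}) (t delta e : R) :
  0 < c ->
  (forall alpha : R, 0 < alpha < 1 -> stable_subordinator alpha c (D alpha)) ->
  0 < t -> 0 < delta -> 0 < e ->
  \forall alpha \near (1 : R)^'-, exists B : set (T alpha),
    [/\ measurable B, (P alpha B <= e%:E)%E &
      forall w, ~ B w -> `|inverse_process (D alpha) t w - t / c| <= delta].
Proof.
move=> c0 SD t0 delta0 e0.
set a := t / c.
(* Replacing delta by h keeps the time a - h nonnegative. *)
pose h := Num.min delta a.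
have a0 : 0 < a by rewrite divr_gt0.
have h0 : 0 < h by rewrite lt_min delta0.
have ha : h <= a by rewrite ge_min lexx orbT.
have ac : a * c = t by rewrite /a divfK// gt_eqF.
have hc : 0 < h * c by rewrite mulr_gt0.
have lo : expR (- t) < expR (- ((a - h) * c)).
  by rewrite ltr_expR mulrBl ac; lra.
have hi : expR (- ((a + h) * c)) < expR (- t).
  by rewrite ltr_expR mulrDl ac; lra.
(* Deviations smaller than eta leave exp (- D (a - h)) above exp (- t) and
   exp (- D (a + h)) below it. *)
pose eta := Num.min (expR (- ((a - h) * c)) - expR (- t))
                    (expR (- t) - expR (- ((a + h) * c))).
have eta0 : 0 < eta by rewrite lt_min !subr_gt0 lo hi.
pose v s alpha : R :=
  eta ^- 2 * (expR (- (s * c * 2 `^ alpha)) - expR (- (2 * (s * c)))).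
have v0 s : v s alpha @[alpha --> (1 : R)^'-] --> 0.
  rewrite -(mulr0 (eta ^- 2)); apply: cvgMl_tmp.
  exact: left_cvg1_stable_variance.
have v_small s : \forall alpha \near (1 : R)^'-, v s alpha <= e / 2.
  have e2 : 0 < e / 2 by rewrite divr_gt0.
  by move/cvgr_lt : (v0 s) => /(_ _ e2); apply: filterS => alpha /ltW.
near=> alpha.
have alpha01 : 0 < alpha < 1.
  apply/andP; split; near: alpha; first exact: nbhs_left_gt.
  exact: nbhs_left_lt.
have [/= N [mN PN subN]] := subordinator_nondecreasing (SD _ alpha01).
pose S s : set (T alpha) :=
  [set w | eta <= `|expR (- D alpha s w) - expR (- (s * c))| ].
have mS s : measurable (S s).
  apply: measurable_normr_ge; apply: measurable_funB => //.
  apply: measurableT_comp; first exact: measurable_expR.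
  exact: measurableT_comp.
have PS s : 0 <= s -> (P alpha (S s) <= (v s alpha)%:E)%E.
  by move=> s0; exact: subordinator_chebyshev (SD _ alpha01) s0 eta0.
exists (S (a - h) `|` S (a + h) `|` N); split.
- by apply: measurableU => //; exact: measurableU.
- apply: (le_trans (measureU2 _ (measurableU _ _ (mS _) (mS _)) mN)).
  rewrite [X in (_ + X)%E]PN adde0.
  apply: (le_trans (measureU2 _ (mS _) (mS _))) => //.
  rewrite (_ : e = e / 2 + e / 2); last by lra.
  rewrite EFinD; apply: leeD.
  + apply: (le_trans (PS _ _)); first by rewrite subr_ge0.
    by rewrite lee_fin; near: alpha; exact: v_small.
  + apply: (le_trans (PS _ _)); first by rewrite addr_ge0// ltW.
    by rewrite lee_fin; near: alpha; exact: v_small.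
- move=> w /not_orP[/not_orP[/negP + /negP +] Nw]; rewrite -!ltNge => S1 S2.
  have Dnd : forall s r : R, 0 <= s -> s <= r -> D alpha s w <= D alpha r w.
    by apply: contrapT => /subN.
  apply: (@le_trans _ _ h); last by rewrite ge_min lexx.
  apply: inverse_process_near => //.
  + apply: ltW; rewrite -ltrN2 -ltr_expR.
    have : eta <= expR (- ((a - h) * c)) - expR (- t) by rewrite ge_min lexx.
    by move: S1; rewrite ltr_norml => /andP[]; lra.
  + rewrite -ltrN2 -ltr_expR.
    have : eta <= expR (- t) - expR (- ((a + h) * c)).
      by rewrite ge_min lexx orbT.
    by move: S2; rewrite ltr_norml => /andP[]; lra.
Unshelve. all: by end_near. Qed.

(** * Replacing the random times by deterministic ones *)

(** Outside the oscillation event of A, of probability uniformly small in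
    alpha, and outside the events on which the inverse of D at t1 or t2 is far
    from t1 / c or t2 / c, the two integrands differ by at most e / 4. *)
Lemma time_changed_expectation_near (R : realType) (c : R)
    (d : R -> measure_display) (T : forall alpha : R, measurableType (d alpha))
    (P : forall alpha : R, probability (T alpha) R)
    (A D : forall alpha : R, R -> {RV (P alpha) >-> R})
    (f : R -> R) (k t1 t2 M e : R) :
  0 < c ->
  (forall alpha : R, 0 < alpha < 1 ->
     class_S_data alpha c (A alpha) (D alpha)) ->
  (forall alpha beta : R, 0 < alpha < 1 -> 0 < beta < 1 ->
     same_law (A alpha) (A beta)) ->
  continuous f -> 0 < M -> (forall x, `|f x| <= M) ->
  0 < t1 -> 0 < t2 -> 0 < e ->
  \forall alpha \near (1 : R)^'-,
    let Y := time_changed (A alpha) (D alpha) in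
    let E1 := ('E_(P alpha)[fun w => f (Y t1 w - k * Y t2 w)%R])%E in
    let E2 := ('E_(P alpha)[fun w =>
                 f (A alpha (t1 / c) w - k * A alpha (t2 / c) w)%R])%E in
    [/\ E1 \is a fin_num, E2 \is a fin_num & `|fine E1 - fine E2| <= e].
Proof.
move=> c0 AD_class A_law fc M0 fM t10 t20 e0.
set a := t1 / c; set b := t2 / c.
have a0 : 0 < a by rewrite divr_gt0.
have b0 : 0 < b by rewrite divr_gt0.
have e4 : 0 < e / 4 by rewrite divr_gt0.
(* Three exceptional events of probability at most p contribute
   2 * (2 * M * (3 * p)) = e / 2 to the error. *)
pose p := e / (24 * M).
have p0 : 0 < p by rewrite divr_gt0// mulr_gt0.
(* The law of A does not depend on alpha, so the size of the neighbourhoods is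
   chosen once, from the process of index 1 / 2. *)
pose half : R := 2^-1.
have half01 : 0 < half < 1 by rewrite invr_gt0 ltr0n/= invf_lt1// ltr1n.
have [n osc_n] : exists n,
    (P half (oscillation (A half : R -> T half -> R) f k a b (e / 4)%R
       n.+1%:R^-1%R) <= p%:E)%E.
  have := oscillation_cvg0 k (class_S_levy (AD_class _ half01)) fc a0 b0 e4.
  move/fine_cvg/cvgr_lt => /(_ _ p0) [n _ Hn]; exists n.
  rewrite -[leLHS]fineK ?lee_fin; first exact: ltW (Hn n (leqnn n)).
  by apply: fin_num_measure; exact: measurable_oscillation.
pose delta : R := n.+1%:R^-1.
have delta0 : 0 < delta by rewrite invr_gt0.
have delta2 : 0 < delta / 2 by rewrite divr_gt0.
have delta_lt : delta / 2 < delta by lra.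
have SD alpha (h : 0 < alpha < 1) := class_S_subordinator (AD_class alpha h).
have near1 := inverse_stable_concentration c0 SD t10 delta2 p0.
have near2 := inverse_stable_concentration c0 SD t20 delta2 p0.
near=> alpha.
have alpha01 : 0 < alpha < 1.
  apply/andP; split; near: alpha; first exact: nbhs_left_gt.
  exact: nbhs_left_lt.
have [B1 [mB1 PB1 HB1]] : exists B : set (T alpha),
    [/\ measurable B, (P alpha B <= p%:E)%E &
      forall w, ~ B w -> `|inverse_process (D alpha) t1 w - a| <= delta / 2].
  by near: alpha; exact: near1.
have [B2 [mB2 PB2 HB2]] : exists B : set (T alpha),
    [/\ measurable B, (P alpha B <= p%:E)%E &
      forall w, ~ B w -> `|inverse_process (D alpha) t2 w - b| <= delta / 2].
  by near: alpha; exact: near2.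
have [/= N [mN PN subN]] := levy_cadlag (class_S_levy (AD_class _ alpha01)).
pose G := oscillation (A alpha : R -> T alpha -> R) f k a b (e / 4) delta.
have mG : measurable G by exact: measurable_oscillation.
have PG : (P alpha G <= p%:E)%E.
  rewrite /G (same_law_oscillation k _ _ fc a0 b0 (A_law _ _ alpha01 half01)).
  exact: osc_n.
pose B := G `|` B1 `|` B2 `|` N.
have mB : measurable B by rewrite /B; do !apply: measurableU => //.
have PB : fine (P alpha B) <= 3 * p.
  rewrite -lee_fin fineK ?fin_num_measure// /B.
  have mGB : measurable (G `|` B1) by exact: measurableU.
  apply: (le_trans (measureU2 _ (measurableU _ _ mGB mB2) mN)).
  rewrite [X in (_ + X)%E]PN adde0.
  apply: (le_trans (measureU2 _ mGB mB2)).
  rewrite (_ : 3 * p = p + p + p); last by lra.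
  rewrite !EFinD; apply: leeD => //.
  by apply: (le_trans (measureU2 _ mG mB1)); exact: leeD.
pose Y := time_changed (A alpha) (D alpha).
have mf := continuous_measurable_fun fc.
have mg : measurable_fun setT (fun w => f (A alpha a w - k * A alpha b w)).
  apply: measurableT_comp => //; apply: measurable_funB => //.
  exact: measurable_funM.
have close w : ~ B w ->
    `|f (Y t1 w - k * Y t2 w) - f (A alpha a w - k * A alpha b w)| <= e / 4.
  move=> /not_orP[/not_orP[/not_orP[Gw B1w] B2w] Nw].
  apply: (oscillation_bound fc _ Gw).
  - by apply: contrapT => /subN.
  - exact: inverse_process_ge0.
  - exact: inverse_process_ge0.
  - exact: le_lt_trans (HB1 _ B1w) delta_lt.
  - exact: le_lt_trans (HB2 _ B2w) delta_lt.
have [f1 f2 E12] := @expectation_perturbation _ _ _ (P alpha)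
  (fun w => f (Y t1 w - k * Y t2 w)) _ M (e / 4) B mg mB (ltW M0)
  (ltW e4) (fun w => fM (Y t1 w - k * Y t2 w)) (fun w => fM _) close.
split => //; apply: (le_trans E12).
have MP : M * fine (P alpha B) <= M * (3 * p) by rewrite ler_pM2l.
have Mp : M * (3 * p) = e / 8.
  by rewrite /p; field; rewrite gt_eqF.
by rewrite Mp in MP; rewrite -mulrA; lra.
Unshelve. all: by end_near. Qed.

(** Both increments have the same law, and X_0 vanishes almost surely. *)
Lemma levy_increment_expectation (d : measure_display) (T : measurableType d)
    (R : realType) (P : probability T R) (X : R -> {RV P >-> R})
    (f : R -> R) (s h : R) :
  levy_process X -> continuous f -> bounded_fun f -> 0 <= s -> 0 <= h ->
  ('E_P[fun w => f (X (s + h) w - X s w)%R] = 'E_P[fun w => f (X h w)])%E.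
Proof.
move=> LX fc fb s0 h0; have mf := continuous_measurable_fun fc.
have mfE : measurable_fun setT (EFin \o f) by exact/measurable_EFinP.
have intf (Z : {RV P >-> R}) : P.-integrable setT (EFin \o f \o Z).
  apply: measurable_bounded_integrable => //.
  - exact: le_lt_trans (probability_le1 _ _) (ltry _).
  - exact: measurableT_comp.
  - have [r [rr Hr]] := fb; exists r; split => // x rx w _; exact: Hr.
have transfer (Z : {RV P >-> R}) :
    'E_P[f \o Z]%E = (\int[pushforward P Z]_y (f y)%:E)%E.
  by rewrite integral_pushforward//= unlock.
transitivity ('E_P[fun w => f (X h w - X 0 w)%R])%E.
  rewrite [LHS](transfer (X (s + h) \- X s)) [RHS](transfer (X h \- X 0)).
  apply: eq_measure_integral => B mB _.
  exact: levy_stationary_increments.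
rewrite unlock; apply: ae_eq_integral => //.
- apply/measurable_EFinP; apply: measurableT_comp => //.
  exact: measurable_funB.
- by apply/measurable_EFinP; exact: measurableT_comp.
- move: (levy_start LX); apply: filterS => w X0 _ /=.
  by rewrite X0 subr0.
Qed.

Theorem proposition1 (R : realType) (c : R)
    (d : R -> measure_display) (T : forall alpha : R, measurableType (d alpha))
    (P : forall alpha : R, probability (T alpha) R)
    (A D : forall alpha : R, R -> {RV (P alpha) >-> R})
    (c_gt0 : 0 < c)
    (AD_class : forall alpha : R, 0 < alpha < 1 ->
       class_S_data alpha c (A alpha) (D alpha))
    (A_law : forall alpha beta : R, 0 < alpha < 1 -> 0 < beta < 1 ->
       same_law (A alpha) (A beta))
    (t t0 : R) (t_gt0 : 0 < t) (t0_gt0 : 0 < t0)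
    (f : R -> R) (f_cont : continuous f) (f_bounded : bounded_fun f) :
  let Y alpha : R -> T alpha -> R := time_changed (A alpha) (D alpha) in
  ('E_(P alpha)[fun w => f (Y alpha (t + t0) w - Y alpha t0 w)%R]
   - 'E_(P alpha)[fun w => f (Y alpha t w)])%E @[alpha --> 1^'-] --> 0%E.
Proof.
move=> Y.
have [M M0 fM] : exists2 M, 0 < M & forall x, `|f x| <= M.
  have [r [rr Hr]] := f_bounded.
  exists (Num.max r 0 + 1); first by rewrite ltr_wpDl// le_max lexx orbT.
  move=> x; apply: (Hr (Num.max r 0 + 1)) => //.
  by apply: (@le_lt_trans _ _ (Num.max r 0)); rewrite ?le_max ?lexx// ltrDl.
pose E1 alpha : \bar R :=
  ('E_(P alpha)[fun w => f (Y alpha (t + t0) w - Y alpha t0 w)%R])%E.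
pose E0 alpha : \bar R := ('E_(P alpha)[fun w => f (Y alpha t w)])%E.
pose Z1 alpha : \bar R := ('E_(P alpha)[fun w =>
  f (A alpha ((t + t0) / c) w - A alpha (t0 / c) w)%R])%E.
pose Z0 alpha : \bar R := ('E_(P alpha)[fun w => f (A alpha (t / c)%R w)])%E.
have E1E alpha : E1 alpha =
    ('E_(P alpha)[fun w => f (Y alpha (t + t0) w - 1 * Y alpha t0 w)%R])%E.
  by congr expectation; apply/funext => w; rewrite mul1r.
have Z1E alpha : Z1 alpha = ('E_(P alpha)[fun w =>
    f (A alpha ((t + t0) / c) w - 1 * A alpha (t0 / c) w)%R])%E.
  by congr expectation; apply/funext => w; rewrite mul1r.
have E0E alpha : E0 alpha =
    ('E_(P alpha)[fun w => f (Y alpha t w - 0 * Y alpha t w)%R])%E.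
  by congr expectation; apply/funext => w; rewrite mul0r subr0.
have Z0E alpha : Z0 alpha = ('E_(P alpha)[fun w =>
    f (A alpha (t / c) w - 0 * A alpha (t / c) w)%R])%E.
  by congr expectation; apply/funext => w; rewrite mul0r subr0.
have near1 e : 0 < e -> \forall alpha \near (1 : R)^'-,
    [/\ E1 alpha \is a fin_num, Z1 alpha \is a fin_num &
      `|fine (E1 alpha) - fine (Z1 alpha)| <= e].
  move=> e0; have := time_changed_expectation_near 1 c_gt0 AD_class A_law
    f_cont M0 fM (addr_gt0 t_gt0 t0_gt0) t0_gt0 e0.
  by apply: filterS => alpha; rewrite E1E Z1E.
have near0 e : 0 < e -> \forall alpha \near (1 : R)^'-,
    [/\ E0 alpha \is a fin_num, Z0 alpha \is a fin_num &
      `|fine (E0 alpha) - fine (Z0 alpha)| <= e].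
  move=> e0; have := time_changed_expectation_near 0 c_gt0 AD_class A_law
    f_cont M0 fM t_gt0 t_gt0 e0.
  by apply: filterS => alpha; rewrite E0E Z0E.
have close e : 0 < e -> \forall alpha \near (1 : R)^'-,
    [/\ E1 alpha \is a fin_num, E0 alpha \is a fin_num &
      `|fine (E1 alpha) - fine (E0 alpha)| <= e].
  move=> e0; have e2 : 0 < e / 2 by rewrite divr_gt0.
  near=> alpha.
  have alpha01 : 0 < alpha < 1.
    apply/andP; split; near: alpha; first exact: nbhs_left_gt.
    exact: nbhs_left_lt.
  have [F1 G1 H1] : [/\ E1 alpha \is a fin_num, Z1 alpha \is a fin_num &
      `|fine (E1 alpha) - fine (Z1 alpha)| <= e / 2].
    by near: alpha; exact: near1.
  have [F0 G0 H0] : [/\ E0 alpha \is a fin_num, Z0 alpha \is a fin_num &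
      `|fine (E0 alpha) - fine (Z0 alpha)| <= e / 2].
    by near: alpha; exact: near0.
  have LA := class_S_levy (AD_class _ alpha01).
  have Z10 : Z1 alpha = Z0 alpha.
    have tc0 : 0 <= t / c by rewrite divr_ge0// ltW.
    have t0c0 : 0 <= t0 / c by rewrite divr_ge0// ltW.
    rewrite /Z1 mulrDl (addrC (t / c)).
    exact: levy_increment_expectation LA f_cont f_bounded t0c0 tc0.
  split => //; rewrite -Z10 in H0.
  rewrite [_ - _](_ : _ = (fine (E1 alpha) - fine (Z1 alpha)) -
                          (fine (E0 alpha) - fine (Z1 alpha))); last by lra.
  by apply: (le_trans (ler_normB _ _)); lra.
apply/fine_cvgP; split.
  have := close _ ltr01; apply: filterS => alpha [F1 F0 _].
  by rewrite fin_numB F1.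
apply/cvgrPdist_le => e e0; have := close _ e0.
apply: filterS => alpha [F1 F0 H]; rewrite sub0r normrN /=.
by rewrite fineB.
Unshelve. all: by end_near. Qed.
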